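(* For every $\gamma\ge 0$ there exists a $\gamma$-resettable scheduling problem such that for every $\omega\in(-1,0]$, the competitive ratio of $\textsc{Mimic}(\gamma,\omega)$ on this problem is at least $3+\gamma$.
   Context: \textbf{$\gamma$-resettable scheduling.} Jobs are handled by an executor that has a set of states, one of which is a distinguished initial state; the executor is in the initial state at time $0$. An input $\mathcal{I}$ is a sequence (also viewed as a set) of jobs released over time; each job $r$ has an arrival time $a(r)$, a weight $w(r)\ge 0$, and possibly other parameters determining its execution. A job cannot be started before its arrival time. $C_{A}(r)$ denotes the completion time of job $r$ under a schedule/algorithm $A$, and the cost is $\mathrm{cost}_A(\mathcal{I})=\sum_{r\in\mathcal{I}} w(r) C_A(r)$. For a time $\tau$, $\mathcal{I}_\tau$ is the set of jobs arriving by time $\tau$. An auxiliary $\tau$-schedule is a problem-specific feasible way of executing a subset of jobs of $\mathcal{I}_\tau$ that starts at time $0$, terminates at time $\tau$, and leaves no job partially executed; $R(A)$ denotes the set of jobs completed by a $\tau$-schedule $A$ when run from time $0$. The problem is $\gamma$-resettable if: (Delayed execution) whenever the executor is in the initial state at a time $t$, it can execute any auxiliary $\tau$-schedule with $\tau\le t$ during $[t,t+\tau)$, and a job completed at time $z$ by the schedule run from time $0$ is now completed at time $t+z$ (unless already executed before); (Resetting) if the executor was in the initial state at time $t$ and executed a $\tau$-schedule ending at $t+\tau$, it can be returned to the initial state using extra time $\gamma\tau$; (Learning minimum) $\min(\mathcal{I})$, the earliest time at which an optimal offline solution may complete some job, satisfies $\min(\mathcal{I})>0$ and is learned by an online algorithm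 at or before time $\min(\mathcal{I})$. \textbf{Competitive ratio.} The competitive ratio of an online algorithm is the infimum of all $c$ such that for every input $\mathcal{I}$ its cost is at most $c\cdot\mathrm{cost}_{\mathrm{OPT}}(\mathcal{I})$, where $\mathrm{OPT}$ is an optimal offline solution. \textbf{Auxiliary schedules $S_\tau$.} For a $\tau$-schedule $A$, $\mathrm{val}_\tau(A)=\sum_{r\in R(A)} w(r)C_A(r) + \tau\cdot w(\mathcal{I}_\tau\setminus R(A))$, where $w(R)=\sum_{r\in R}w(r)$. $S_\tau$ is a $\tau$-schedule minimizing $\mathrm{val}_\tau$, ties broken arbitrarily but deterministically. \textbf{Routine $\textsc{Mimic}(\gamma,\omega)$}, $\omega\in(-1,0]$: let $\alpha=2+\gamma$ and $\tau_k=\min(\mathcal{I})\cdot\alpha^{k+\omega}$. It does nothing until time $\tau_1$. For each $k\ge 1$, at time $\tau_k$ (when the executor is in the initial state) it computes $S_{\tau_k}$, executes it during $[\tau_k,2\tau_k)$ (without interruption or modification by later jobs), serving only those jobs of $S_{\tau_k}$ not served earlier, and then resets the executor in time $\gamma\tau_k$, so it is in the initial state at time $\alpha\tau_k=\tau_{k+1}$. *)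

(* Defs.v *)
From HB Require Import structures.
From mathcomp Require Import all_boot all_order all_algebra.
From mathcomp Require Import all_classical all_reals all_analysis.

Set Implicit Arguments.
Unset Strict Implicit.
Unset Printing Implicit Defensive.

Import Order.TTheory GRing.Theory Num.Theory.
Local Open Scope classical_set_scope.
Local Open Scope ring_scope.

(* What an execution does over the time horizon [0, +oo[: the trajectory of
   the executor (only its values at times >= 0 matter) and, for each job, the
   times at which its execution starts and completes, +oo standing for
   "never". *)
Record schedule (R : realType) (St J : Type) := Schedule {
  state_at : R -> St;
  start : J -> \bar R;
  compl : J -> \bar R }.

(* The executed jobs R(A) of a schedule. *)
Definition completes (R : realType) (St J : Type) (A : schedule R St J) (r : J)
  : bool := (compl A r < +oo)%E.

(* [upto a t I] is the part I_t of I arriving by time t. *)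
Definition upto (R : realType) (J : Type) (a : J -> R) (t : R) (I : seq J)
  : seq J := [seq r <- I | a r <= t].

Definition input (R : realType) (J : eqType) (a : J -> R) (I : seq J) : Prop :=
  [/\ I != [::], uniq I & sorted (fun r s => a r <= a s) I].

Definition val_tau (R : realType) (St : Type) (J : eqType) (w : J -> R)
    (X : seq J) (tau : R) (A : schedule R St J) : \bar R :=
  (\sum_(r <- X | completes A r) (w r)%:E * compl A r
   + tau%:E * \sum_(r <- X | ~~ completes A r) (w r)%:E)%E.

(* [feasible I B]: B is a possible execution, from time 0 on, when the input
   is I; it need not complete, nor even start, all jobs.
   [aux X tau A]: A is an auxiliary tau-schedule, where X is the set of jobs
   arriving by time tau.  The behavior of A after time tau is irrelevant.
   [aux_truncate] says that there are enough tau-schedules: what an execution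
   has completed by time tau can also be completed, at the same times, by a
   tau-schedule, the jobs still unfinished at time tau being left out. *)
Record sched_problem (R : realType) := SchedProblem {
  state : Type;
  init : state;
  job : eqType;
  arrival : job -> R;
  weight : job -> R;
  feasible : seq job -> schedule R state job -> Prop;
  aux : seq job -> R -> schedule R state job -> Prop;
  arrival_ge0 : forall r, 0 <= arrival r;
  weight_ge0 : forall r, 0 <= weight r;
  feasible_init : forall I B, feasible I B -> state_at B 0 = init;
  feasible_start : forall I B r, feasible I B ->
    ((arrival r)%:E <= start B r)%E /\ (start B r <= compl B r)%E;
  feasible_job : forall I B r, feasible I B -> r \notin I ->
    start B r = +oo%E;
  aux_feasible : forall X tau A, aux X tau A -> feasible X A;
  aux_complete : forall X tau A r, aux X tau A ->
    (start A r < +oo)%E -> (compl A r <= tau%:E)%E;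
  aux_truncate : forall I B tau, input arrival I -> feasible I B -> 0 <= tau ->
    exists A, aux (upto arrival tau I) tau A /\
      forall r, compl A r =
        if (compl B r <= tau%:E)%E then compl B r else +oo%E;
  aux_minimizer : forall I tau, input arrival I -> 0 <= tau ->
    exists A, aux (upto arrival tau I) tau A /\
      forall A', aux (upto arrival tau I) tau A' ->
        (val_tau weight (upto arrival tau I) tau A
         <= val_tau weight (upto arrival tau I) tau A')%E }.

Definition sched (R : realType) (P : sched_problem R) : Type :=
  schedule R (state P) (job P).

Definition arrived (R : realType) (P : sched_problem R) (t : R)
  (I : seq (job P)) : seq (job P) := upto (@arrival R P) t I.

(* As 0 * +oo = 0 in \bar R, weightless jobs never contribute to the cost,
   even when they are not completed. *)
Definition cost (R : realType) (P : sched_problem R) (I : seq (job P))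
    (B : sched P) : \bar R :=
  (\sum_(r <- I) (weight r)%:E * compl B r)%E.

Definition solution (R : realType) (P : sched_problem R) (I : seq (job P))
    (B : sched P) : Prop :=
  feasible I B /\ forall r, r \in I -> completes B r.

Definition optimal (R : realType) (P : sched_problem R) (I : seq (job P))
    (B : sched P) : Prop :=
  solution I B /\ forall B', solution I B' -> (cost I B <= cost I B')%E.

(* [is_min I m]: m = min(I). *)
Definition is_min (R : realType) (P : sched_problem R) (I : seq (job P))
    (m : R) : Prop :=
  (exists O r, [/\ optimal I O, r \in I & compl O r = m%:E]) /\
  (forall O r, optimal I O -> r \in I -> (m%:E <= compl O r)%E).

(* B' has the same history as B before time t.  A job completed by B exactly
   at time t counts as completed; B' may moreover complete at time t a job
   that B does not complete by time t. *)
Definition same_past (R : realType) (P : sched_problem R) (t : R)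
    (B B' : sched P) : Prop :=
  (forall s, 0 <= s <= t -> state_at B' s = state_at B s) /\
  (forall r,
    [/\ (start B r < t%:E)%E -> start B' r = start B r,
        (t%:E <= start B r)%E -> (t%:E <= start B' r)%E,
        (compl B r <= t%:E)%E -> compl B' r = compl B r
      & (t%:E < compl B r)%E -> (t%:E <= compl B' r)%E]).

(* B' behaves as B before time t and executes the tau-schedule A during
   [t, t + tau[, skipping the jobs already completed. *)
Definition executes (R : realType) (P : sched_problem R) (t tau : R)
    (A B B' : sched P) : Prop :=
  same_past t B B' /\
  forall r, (t%:E < compl B r)%E ->
    if completes A r then
      compl B' r = (t%:E + compl A r)%E /\
      ((t%:E <= start B r)%E -> start B' r = (t%:E + start A r)%E)
    else
      ((t + tau)%:E <= compl B' r)%E /\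
      ((t%:E <= start B r)%E -> ((t + tau)%:E <= start B' r)%E).

Definition delayed_execution (R : realType) (P : sched_problem R) : Prop :=
  forall (I : seq (job P)) (t tau : R) (A B : sched P),
    input (@arrival R P) I -> 0 <= tau <= t ->
    aux (arrived tau I) tau A ->
    feasible I B -> state_at B t = init P ->
    exists B', feasible I B' /\ executes t tau A B B'.

Definition resetting (R : realType) (gamma : R) (P : sched_problem R) : Prop :=
  forall (I : seq (job P)) (t tau : R) (A B B' : sched P),
    input (@arrival R P) I -> 0 <= tau <= t ->
    aux (arrived tau I) tau A ->
    feasible I B -> state_at B t = init P ->
    feasible I B' -> executes t tau A B B' ->
    exists B'', [/\ feasible I B'', same_past (t + tau) B' B''
      & state_at B'' (t + tau + gamma * tau) = init P].

(* What an online algorithm knows at time t is I_t, so min(I) is learned by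
   time t when it is the same for all inputs that coincide up to time t. *)
Definition learning_minimum (R : realType) (P : sched_problem R) : Prop :=
  forall I : seq (job P), input (@arrival R P) I ->
    exists m, [/\ is_min I m, 0 < m
      & exists2 t, t <= m & forall I' : seq (job P),
          input (@arrival R P) I' -> arrived t I' = arrived t I -> is_min I' m].

Definition resettable (R : realType) (gamma : R) (P : sched_problem R)
  : Prop :=
  [/\ delayed_execution P, resetting gamma P & learning_minimum P].

(* A choice of S_tau; it depends on the jobs arriving by time tau only. *)
Definition aux_choice (R : realType) (P : sched_problem R)
    (S : seq (job P) -> R -> sched P) : Prop :=
  forall (I : seq (job P)) (tau : R),
    input (@arrival R P) I -> 0 <= tau ->
    let X := arrived tau I in
    aux X tau (S X tau) /\
    forall A, aux X tau A ->
      (val_tau (@weight R P) X tau (S X tau)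
       <= val_tau (@weight R P) X tau A)%E.

Definition tau_ (R : realType) (gamma omega m : R) (k : nat) : R :=
  m * (2 + gamma) `^ (k%:R + omega).

(* [mimic gamma omega S I B]: B is the schedule produced on input I by Mimic,
   S being the tie-breaking rule.  A job is served by the first phase k >= 1
   whose auxiliary schedule contains it; nothing else is ever executed. *)
Definition mimic (R : realType) (P : sched_problem R) (gamma omega : R)
    (S : seq (job P) -> R -> sched P) (I : seq (job P)) (B : sched P) : Prop :=
  exists2 m, is_min I m &
  let tau := tau_ gamma omega m in
  let Sk k := S (arrived (tau k) I) (tau k) in
  [/\ feasible I B,
      forall t, 0 <= t <= tau 1%N -> state_at B t = init P,
      forall k, (1 <= k)%N -> state_at B (tau k) = init P,
      forall k r, (1 <= k)%N -> completes (Sk k) r ->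
        (forall j, (1 <= j < k)%N -> ~~ completes (Sk j) r) ->
        start B r = ((tau k)%:E + start (Sk k) r)%E /\
        compl B r = ((tau k)%:E + compl (Sk k) r)%E
    & forall r, (forall k, (1 <= k)%N -> ~~ completes (Sk k) r) ->
        start B r = +oo%E].

(* [alg I B]: B is a schedule produced on input I by the algorithm. *)
Definition competitive_ratio (R : realType) (P : sched_problem R)
    (alg : seq (job P) -> sched P -> Prop) : \bar R :=
  ereal_inf [set c%:E | c in [set c : R | forall I B O,
    input (@arrival R P) I -> alg I B -> optimal I O ->
    (cost I B <= c%:E * cost I O)%E]].

(* Main.v *)
(* On infinitely many parallel machines, every job can be started at once, so
   no reset is ever needed and the problem is gamma-resettable for each gamma.
   On two unit-weight jobs of processing times 1 and tau_k + 1, the optimum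
   costs tau_k + 2.  The long job fits into no auxiliary schedule before the
   one of phase k + 1, so Mimic completes it no earlier than at
   tau_(k+1) + tau_k + 1 = (3 + gamma) tau_k + 1.  Let k tend to infinity. *)
Require Import Defs.
From HB Require Import structures.
From mathcomp Require Import all_boot all_order all_algebra.
From mathcomp Require Import all_classical all_reals all_analysis.
From mathcomp Require Import lra.
Set Implicit Arguments.
Unset Strict Implicit.
Unset Printing Implicit Defensive.
Import Order.TTheory GRing.Theory Num.Theory.
Local Open Scope ring_scope.

(** * Infinitely many parallel machines as a scheduling problem *)

Section ParallelMachines.
Variable R : realType.

(* A job is identified with its processing time. *)
Notation job := {posnum R}.
Notation psched := (schedule R unit job).
Implicit Types (r : job) (I : seq job) (A B : psched).

Let arr r : R := 0.
Let wgt r : R := 1.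

(* The inequality lets a started job be completed late, as required when a
   delayed schedule serves a job that is already running. *)
Definition machine_feasible I B : Prop :=
  forall r, [/\ r \notin I -> start B r = +oo%E,
    (0 <= start B r)%E & (start B r + r%:num%:E <= compl B r)%E].

Definition machine_aux I tau A : Prop :=
  machine_feasible I A /\
  forall r, (start A r < +oo)%E -> (compl A r <= tau%:E)%E.

(** The bound is an extended real so that finite [tau] yields a minimizer of [val_tau] and [+oo] the
    offline optimum. *)
Definition eager I (tau : \bar R) : psched :=
  Schedule (fun=> tt)
    (fun r => if (r \in I) && (r%:num%:E <= tau)%E then 0%E else +oo%E)
    (fun r => if (r \in I) && (r%:num%:E <= tau)%E then r%:num%:E else +oo%E).

Lemma upto_arr tau I : 0 <= tau -> upto arr tau I = I.
Proof. by move=> tau0; apply/all_filterP/allP => r _. Qed.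

Lemma compl_ge I B r : machine_feasible I B -> (r%:num%:E <= compl B r)%E.
Proof.
by move=> /(_ r)[_ s0 sc]; apply: le_trans sc; rewrite leeDr.
Qed.

Lemma start_le_compl I B r : machine_feasible I B ->
  (start B r <= compl B r)%E.
Proof. by move=> /(_ r)[_ s0 sc]; apply: le_trans sc; rewrite leeDl. Qed.

Lemma completes_start I B r : machine_feasible I B -> completes B r ->
  (start B r < +oo)%E.
Proof. by move=> /(start_le_compl r)/le_lt_trans; apply. Qed.

Lemma completes_mem I B r : machine_feasible I B -> completes B r -> r \in I.
Proof.
move=> fB cB; apply/negPn/negP => rI; have := completes_start fB cB.
by have [-> //] := fB r; rewrite ltxx.
Qed.

Lemma eager_feasible I tau : machine_feasible I (eager I tau).
Proof.
move=> r; rewrite /=; split; first by move/negPf ->.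
- by case: ifP; rewrite ?leey.
- by case: ifP => _; rewrite ?add0e ?leey.
Qed.

(** * Auxiliary schedules of minimal value *)

Lemma eager_aux I tau : machine_aux I tau (eager I tau%:E).
Proof.
split; first exact: eager_feasible.
by move=> r /=; case: ifP => [/andP[]|]; rewrite // ltxx.
Qed.

(** One term per job allows schedules to be compared job by job. *)
Lemma val_tauE I tau A : (forall r, (0 <= compl A r)%E) -> 0 <= tau ->
  val_tau wgt I tau A =
  (\sum_(r <- I) (if completes A r then compl A r else tau%:E))%E.
Proof.
move=> c0 tau0; rewrite /val_tau ge0_sume_distrr//.
rewrite [RHS](bigID (completes A))/=; congr (_ + _)%E.
- by apply: eq_bigr => r ->; rewrite mul1e.
- by apply: eq_bigr => r /negPf->; rewrite mule1.
Qed.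

Lemma compl_ge0 I B r : machine_feasible I B -> (0 <= compl B r)%E.
Proof. by move=> /(compl_ge r); apply: le_trans. Qed.

(** A job that fits into [tau] contributes its processing time, the least possible; a longer one is
    completed by no [tau]-schedule and always contributes [tau]. *)
Lemma eager_minimizer I tau A : 0 <= tau -> machine_aux I tau A ->
  (val_tau wgt I tau (eager I tau%:E) <= val_tau wgt I tau A)%E.
Proof.
move=> tau0 [fA dA]; rewrite !val_tauE//; first last.
- by move=> r; exact: compl_ge0 (eager_feasible I tau%:E).
- by move=> r; exact: compl_ge0 fA.
rewrite big_seq [leRHS]big_seq; apply: lee_sum => r rI.
rewrite [completes (eager _ _) _]/completes /= rI /= [(_ <= tau%:E)%E]lee_fin.
case: (leP r%:num tau) => rt.
- by rewrite ltry; case: ifP => _; [exact: compl_ge fA|rewrite lee_fin].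
- rewrite ltxx; case: ifPn => // cA.
  have := dA _ (completes_start fA cA).
  by move/(le_trans (compl_ge r fA)); rewrite lee_fin leNgt rt.
Qed.

Lemma aux_truncate_machine I B tau : machine_feasible I B ->
  exists A, machine_aux I tau A /\ forall r, compl A r =
    if (compl B r <= tau%:E)%E then compl B r else +oo%E.
Proof.
move=> fB.
exists (Schedule (fun=> tt)
  (fun r => if (compl B r <= tau%:E)%E then start B r else +oo%E)
  (fun r => if (compl B r <= tau%:E)%E then compl B r else +oo%E)).
split=> //; split=> r /=; last by case: ifP; rewrite // ltxx.
by have [sI s0 sc] := fB r; case: ifP => _; split; rewrite ?leey.
Qed.

Lemma machine_feasible_start I B r : machine_feasible I B ->
  ((arr r)%:E <= start B r)%E /\ (start B r <= compl B r)%E.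
Proof.
by move=> fB; split; [have [] := fB r | exact: start_le_compl fB].
Qed.

(** The executor has a single state, hence is always in the initial one. *)
Definition machines : sched_problem R.
Proof.
refine (@SchedProblem R unit tt job arr wgt machine_feasible machine_aux
  (fun=> lexx 0) (fun=> ler01) _ machine_feasible_start _ _ _ _ _).
- by move=> I B _; case: (state_at B 0).
- by move=> I B r /(_ r)[].
- by move=> X tau A [].
- by move=> X tau A r [_]; apply.
- by move=> I B tau _ fB /upto_arr->; exact: aux_truncate_machine.
- move=> I tau _ tau0; exists (eager I tau%:E); rewrite upto_arr//.
  by split; [exact: eager_aux|move=> A; exact: eager_minimizer].
Defined.

(** * Delayed execution and resetting *)

Lemma machines_delayed : delayed_execution machines.
Proof.
move=> I t tau A B _ /andP[tau0 taut] + fB _.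
rewrite [arrived _ _]upto_arr// => -[fA _].
have t0 : 0 <= t by exact: le_trans taut.
(* Jobs completed by [t] or running at [t] keep their start. The others follow [A] shifted by [t].
   What is unfinished at [t] and left out by [A] is never completed. *)
pose s r : \bar R := if (compl B r <= t%:E)%E || (start B r < t%:E)%E
  then start B r
  else if completes A r then (t%:E + start A r)%E else +oo%E.
pose c r : \bar R := if (compl B r <= t%:E)%E then compl B r
  else if completes A r then (t%:E + compl A r)%E else +oo%E.
exists (Schedule (fun=> tt) s c); split.
- move=> r; rewrite /= /s /c.
  have [sI s0 sc] := fB r; have [AI A0 Ac] := fA r.
  split.
  + move=> rI; rewrite (sI rI); case: ifP => // _.
    by case: ifPn => // /(completes_mem fA); rewrite (negPf rI).
  + by case: ifP => // _; case: ifP; rewrite ?leey// adde_ge0.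
  + case: (leP (compl B r)) => //= _; case: (completes A r); rewrite ?leey//.
    (* A running job started before [t], and [compl A r] is at least its processing time, so
       completing it at [t + compl A r] is late enough. *)
    case: ifP => [/ltW st|_]; last by rewrite -addeA leeD2l.
    by apply: leeD st _; exact: compl_ge fA.
- split.
    split; first by move=> u _; case: (state_at B u).
    move=> r; rewrite /= /s /c; have [_ A0 _] := fA r.
    split.
    + by move=> ->; rewrite orbT.
    + by case: ifP => // _ _; case: ifP; rewrite ?leey// leeDl.
    + by move=> ->.
    + move=> /[dup] tc; rewrite ltNge => /negPf->.
      by case: ifP; rewrite ?leey// leeDl// (compl_ge0 r fA).
  move=> r; rewrite /= /s /c ltNge => /negPf->/=.
  case: ifP => ->; split; rewrite ?leey//.
  + by rewrite leNgt => /negPf->.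
  + by rewrite leNgt => /negPf->; rewrite leey.
Qed.

Lemma machines_resetting gamma : resetting gamma machines.
Proof.
move=> I t tau A B B' _ _ _ _ _ fB' _; exists B'; split=> //.
- by split=> // r; split=> // /ltW.
- by case: (state_at B' _).
Qed.

(** * The offline optimum and the learning of [min(I)] *)

Lemma eager_solution I : solution (P := machines) I (eager I +oo).
Proof.
split; first exact: eager_feasible.
by move=> r rI; rewrite /completes /= rI leey/= ltry.
Qed.

Lemma cost_eager I :
  cost (P := machines) I (eager I +oo) = (\sum_(r <- I) r%:num%:E)%E.
Proof.
rewrite /cost big_seq [RHS]big_seq; apply: eq_bigr => r rI.
by rewrite /= rI leey mul1e.
Qed.

(** Every job attains its own lower bound, its processing time. *)
Lemma eager_optimal I : optimal (P := machines) I (eager I +oo).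
Proof.
split; first exact: eager_solution.
move=> B [fB _]; rewrite cost_eager; apply: lee_sum => r _.
by rewrite mul1e; exact: compl_ge fB.
Qed.

Lemma machines_is_min I r : r \in I ->
  (forall s : job, s \in I -> r%:num <= s%:num) ->
  is_min (P := machines) I r%:num.
Proof.
move=> rI rmin; split.
- exists (eager I +oo), r; split=> //; first exact: eager_optimal.
  by rewrite /= rI leey.
- move=> B s [[fB _] _] sI; apply: le_trans (compl_ge s fB).
  by rewrite lee_fin rmin.
Qed.

Lemma shortest_job I : I != [::] ->
  exists2 r, r \in I & forall s : job, s \in I -> r%:num <= s%:num.
Proof.
elim: I => // r I IH _; have [->|/IH[r' r'I r'min]] := eqVneq I [::].
  by exists r; rewrite ?mem_head// => s; rewrite inE => /eqP->.
have [rr'|/ltW r'r] := leP r%:num r'%:num.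
- exists r; rewrite ?mem_head// => s /predU1P[->//|/r'min].
  exact: le_trans.
- by exists r'; rewrite ?inE ?r'I ?orbT// => s /predU1P[->//|/r'min].
Qed.

Lemma machines_learning : learning_minimum machines.
Proof.
move=> I [I0 _ _]; have [r rI rmin] := @shortest_job I I0.
have mI := @machines_is_min I r rI rmin.
(* All jobs arrive at time 0, so the whole input is known then. *)
exists r%:num; split=> //; exists 0 => // I' _.
by rewrite /arrived !upto_arr// => ->.
Qed.

Lemma machines_resettable gamma : resettable gamma machines.
Proof.
split; [exact: machines_delayed | exact: machines_resetting|].
exact: machines_learning.
Qed.

(** * The lower bound for Mimic *)

Section Mimic.
Variables (gamma omega : R).
Hypotheses (gamma_ge0 : 0 <= gamma) (omega_gtN1 : -1 < omega).

Lemma le_tau_ (m : R) j k : 0 <= m -> (j <= k)%N ->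
  tau_ gamma omega m j <= tau_ gamma omega m k.
Proof.
have g0 := gamma_ge0.
move=> m0 jk; rewrite ler_wpM2l// ler_powR//; first lra.
by rewrite lerD2r ler_nat.
Qed.

Lemma tau_S (m : R) k :
  tau_ gamma omega m k.+1 = (2 + gamma) * tau_ gamma omega m k.
Proof.
have a0 : 0 < 2 + gamma by have g0 := gamma_ge0; lra.
rewrite /tau_ -[k.+1%:R]natr1 (addrAC k%:R) powRD; last first.
  by apply/implyP => _; exact: lt0r_neq0.
by rewrite powRr1 ?ltW// mulrA mulrC.
Qed.

(** Since [omega > -1], the right-hand side is at least [(2 + gamma)^k >= 2^k > k]. So the phase
    times are unbounded. *)
Lemma tau_gt k : k%:R < tau_ gamma omega 1 k.+1.
Proof.
have [g0 o1] := (gamma_ge0, omega_gtN1).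
rewrite /tau_ mul1r; apply: (@lt_le_trans _ _ ((2 + gamma) `^ k%:R)).
  rewrite powR_mulrn; last lra.
  apply: (@lt_le_trans _ _ (2 ^+ k)); last by rewrite lerXn2r ?nnegrE; lra.
  by rewrite -natrX ltr_nat ltn_expl.
by rewrite ler_powR -?natr1; lra.
Qed.

Variable S : seq job -> R -> sched machines.
Hypothesis SP : aux_choice (P := machines) S.

(** A job longer than [tau k] fits into none of the first [k] phases, so it starts at [tau k.+1] or
    later. Existence matters as well: an input without a Mimic schedule would not constrain the
    competitive ratio. *)
Lemma mimic_late I m : input arr I -> is_min (P := machines) I m -> 0 < m ->
  exists2 B, mimic (P := machines) gamma omega S I B &
    forall r k, tau_ gamma omega m k < r%:num ->
      ((tau_ gamma omega m k.+1 + r%:num)%:E <= compl B r)%E.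
Proof.
move=> inI mI m0; set tau := tau_ gamma omega m.
have tau0 k : 0 <= tau k by rewrite mulr_ge0 ?powR_ge0// ltW.
pose Sk k : psched := S (upto arr (tau k) I) (tau k).
have Saux k : machine_aux I (tau k) (Sk k).
  have [] := SP inI (tau0 k).
  by rewrite /arrived /Sk upto_arr.
pose served r k := (0 < k)%N && completes (Sk k) r.
(* Conditions on the start and completion of [r]: Mimic's rule (two clauses), feasibility, lateness.
   None couples two jobs, so the schedule can be chosen job by job. *)
pose spec r (sc : \bar R * \bar R) :=
  [/\ forall k, served r k -> (forall j, (0 < j < k)%N -> ~~ served r j) ->
        sc.1 = ((tau k)%:E + start (Sk k) r)%E /\
        sc.2 = ((tau k)%:E + compl (Sk k) r)%E,
      (forall k, ~~ served r k) -> sc.1 = +oo%E,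
      [/\ r \notin I -> sc.1 = +oo%E, (0 <= sc.1)%E
        & (sc.1 + r%:num%:E <= sc.2)%E]
    & forall k, tau k < r%:num -> ((tau k.+1 + r%:num)%:E <= sc.2)%E].
have /choice[f fP] : forall r, exists sc, spec r sc.
  move=> r; have [ex|nex] := pselect (exists k, served r k); last first.
    exists (+oo, +oo)%E; split=> //=.
    - by move=> k rk; case: nex; exists k.
    - by move=> k _; rewrite leey.
  (* Mimic serves [r] in the first phase that contains it. *)
  case: (ex_minnP ex) => k rk kmin.
  have [fS dS] := Saux k; have [k0 ck] := andP rk.
  exists ((tau k)%:E + start (Sk k) r, (tau k)%:E + compl (Sk k) r)%E.
  split=> /=.
  - move=> j rj jmin; suff -> : j = k by [].
    apply/eqP; rewrite eqn_leq kmin// andbT leqNgt; apply/negP => kj.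
    by have := jmin k; rewrite k0 kj rk => /(_ isT).
  - by move=> /(_ k); rewrite rk.
  - have [sI s0 sc] := fS r; split.
    + by rewrite (completes_mem fS ck).
    + by rewrite adde_ge0// lee_fin.
    + by rewrite -addeA leeD2l.
  - move=> j jr; rewrite EFinD leeD//; last exact: compl_ge fS.
    (* If [k <= j], then [r] would be completed within [tau k <= tau j], less than its processing
       time. *)
    rewrite lee_fin le_tau_ ?ltW// ltnNge; apply/negP => kj.
    have := le_trans (compl_ge r fS) (dS r (completes_start fS ck)).
    rewrite lee_fin leNgt (le_lt_trans _ jr)//.
    by rewrite le_tau_ ?ltW.
pose B : psched := Schedule (fun=> tt) (fun r => (f r).1) (fun r => (f r).2).
exists B; last by move=> r; case: (fP r).
exists m => //; split=> //.
- by move=> r; case: (fP r).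
- move=> k r k1 ck jmin; case: (fP r) => + _ _ _; apply.
  + by rewrite /served k1.
  + move=> j /[dup] /andP[j0 _] /jmin; by rewrite /served j0.
- move=> r nc; case: (fP r) => _ + _ _; apply=> k.
  by apply/negP => /andP[/nc/negP].
Qed.

(** The short job fixes [min(I) = 1] and thus all phase times, so the long one can be made just too
    long for phase [k]. *)
Lemma ratio_ge_tau c k :
  (forall I B O, input arr I -> mimic (P := machines) gamma omega S I B ->
    optimal (P := machines) I O ->
    (cost (P := machines) I B <= c%:E * cost (P := machines) I O)%E) ->
  (3 + gamma) * tau_ gamma omega 1 k + 1 <= c * (tau_ gamma omega 1 k + 2).
Proof.
move=> cP; set t := tau_ gamma omega 1 k.
have t0 : 0 < t by have g0 := gamma_ge0; rewrite mulr_gt0// powR_gt0//; lra.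
have t1 : 0 < t + 1 by lra.
pose short : job := PosNum (@ltr01 R); pose long : job := PosNum t1.
pose I := [:: short; long].
have inI : input arr I.
  split=> //=; last by rewrite lexx.
  by rewrite inE andbT -(inj_eq val_inj); apply/eqP => /= h; lra.
have mI : is_min (P := machines) I short%:num.
  apply: machines_is_min; first exact: mem_head.
  by move=> s; rewrite !inE => /orP[] /eqP->/=; lra.
have [B mB lateB] := mimic_late inI mI ltr01.
have := cP I B _ inI mB (@eager_optimal I).
rewrite cost_eager /cost !big_cons !big_nil !adde0 !mul1e /= => cB.
have t_long : t < long%:num by rewrite /= ltrDl.
have := lateB long k t_long; rewrite tau_S -/t /= => lB.
(* The cost of the short job is bounded below by 0 only; the long job alone gives the bound. *)
have B0 : (0 <= compl B short)%E.
  by case: mB => m _ [fB _ _ _ _]; exact: compl_ge0 fB.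
have := le_trans lB (le_trans (leeDr _ B0) cB).
by rewrite -EFinD -EFinM lee_fin; nra.
Qed.

Lemma mimic_ratio :
  ((3 + gamma)%:E <= competitive_ratio (mimic (P := machines) gamma omega S))%E.
Proof.
apply: le_ereal_inf_tmp => _ [c cP <-]; rewrite lee_fin leNgt; apply/negP => clt.
have d0 : 0 < 3 + gamma - c by rewrite subr_gt0.
(* For [c < 3 + gamma], the inequality of [ratio_ge_tau] amounts to [t <= x]; a phase time beyond
   [x] refutes it. *)
pose x := (2 * c - 1) / (3 + gamma - c).
have xt := lt_trans (truncnS_gt x) (tau_gt (Num.truncn x).+1).
have := ratio_ge_tau (Num.truncn x).+2 cP; set t := tau_ _ _ _ _ in xt *.
by move: xt; rewrite /x ltr_pdivrMr//= => xt; lra.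
Qed.

End Mimic.
End ParallelMachines.

Theorem theorem14 (R : realType) (gamma : R) (hgamma : 0 <= gamma) :
  exists P : sched_problem R,
    resettable gamma P /\
    forall omega : R, -1 < omega <= 0 ->
    forall S : seq (job P) -> R -> sched P, aux_choice S ->
    ((3 + gamma)%:E <= competitive_ratio (mimic gamma omega S))%E.
Proof.
exists (machines R); split; first exact: machines_resettable.
by move=> omega /andP[omega_gtN1 _] S; exact: mimic_ratio.
Qed.
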